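(* Let $P\in\mathcal C_3^{\mathrm{nd}}$ have rank two, let $q=(q_1,q_2,q_3)^T\ne0$ span $\ker P$, and put $s(q)=q_1+q_2+q_3$. Choose any full-column-rank Gram factor $P=XX^T$ with $X\in\mathbb R^{3\times2}$, and set $S=X^TH_3X$. Then the following statements hold. 1. $s(q)=0$ if and only if $\operatorname{rank}C(P)=1$. In this case $C(P)$ is one of the three nondegenerate rank-one patterned fixed points $A(1,-1,-1)$, $A(-1,1,-1)$, $A(-1,-1,1)$. 2. If $s(q)\ne0$, then $S\succ0$, $\operatorname{rank}C(P)=2$, and $\kappa(C(P))=[D(P)q]$; that is, $\ker C(P)$ is spanned by $q^+=D(P)q$. 3. If $s(q)\ne0$, then for every $i,j\in\{1,2,3\}$, $$d_i(P)^2-d_j(P)^2=\frac{2\det(S)}{s(q)}(q_i-q_j).$$ The scalar $\det(S)$ is independent of the chosen full-column-rank Gram factor $X$. 4. If $s(q)\ne 0$, then after replacing $q$ by $-q$ if necessary so that $s(q)>0$, one has for all $i,j\in\{1,2,3\}$ $$q_i>q_j\iff d_i(P)>d_j(P).$$ In particular, if $q_i=q_j$, then the equality of these two kernel coordinates is preserved by the next rank-two iterate (the vector $q^+=D(P)q$ spanning $\ker C(P)$ satisfies $q_i^+=q_j^+$).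
   Context: For nonconstant $x,y\in\mathbb R^3$, with means $\bar x,\bar y$, the Pearson correlation is $\operatorname{corr}(x,y)=\frac{\sum_k(x_k-\bar x)(y_k-\bar y)}{\sqrt{\sum_k(x_k-\bar x)^2\sum_k(y_k-\bar y)^2}}$. For a real $3\times3$ matrix with nonconstant rows $r_1,r_2,r_3$, the correlation map is $[C(P)]_{ij}=\operatorname{corr}(r_i,r_j)$. $\mathcal C_3$ is the set of real symmetric positive semidefinite $3\times3$ matrices with unit diagonal, and $\mathcal C_3^{\mathrm{nd}}$ is the set of $P\in\mathcal C_3$ all of whose rows are nonconstant. $A(a,b,c)=\begin{pmatrix} 1 & a & b \\ a & 1 & c \\ b & c & 1 \end{pmatrix}$. $H_3=I_3-\frac13\mathbf1\mathbf1^T$ with $\mathbf1=(1,1,1)^T$. For $P\in\mathcal C_3^{\mathrm{nd}}$, $d_i(P)=\|P_{i,:}H_3\|>0$ (Euclidean norm, $P_{i,:}$ the $i$-th row) and $D(P)=\operatorname{diag}(d_1(P),d_2(P),d_3(P))$. For $q\in\mathbb R^3\setminus\{0\}$, $[q]=\operatorname{span}\{q\}$ is the corresponding point of the real projective plane; for a rank-two $P\in\mathcal C_3^{\mathrm{nd}}$, $\kappa(P)=[q]$ where $q\neq 0$ is any vector spanning the one-dimensional space $\ker P$. $S\succ0$ means $S$ is positive definite. *)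

(* Defs.v *)
From HB Require Import structures.
From mathcomp Require Import all_boot all_order all_algebra.
From mathcomp Require Import reals.

Set Implicit Arguments.
Unset Strict Implicit.
Unset Printing Implicit Defensive.

Import Order.TTheory GRing.Theory Num.Theory.
Local Open Scope ring_scope.

(* Indices 1, 2, 3 of the mathematics are 0, 1, 2 : 'I_3.  Rows of a matrix are
   row vectors; kernel vectors q are column vectors, with entries q i 0. *)

Definition nonconst (R : realType) (x : 'rV[R]_3) : Prop :=
  exists k l : 'I_3, x 0 k != x 0 l.

Definition mean (R : realType) (x : 'rV[R]_3) : R := (\sum_k x 0 k) / 3%:R.

(* Meaningful for nonconstant x and y only; otherwise the denominator is 0 and
   the value is the junk value 0. *)
Definition corr (R : realType) (x y : 'rV[R]_3) : R :=
  (\sum_k (x 0 k - mean x) * (y 0 k - mean y)) /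
  Num.sqrt ((\sum_k (x 0 k - mean x) ^+ 2) * (\sum_k (y 0 k - mean y) ^+ 2)).

Definition corrmap (R : realType) (P : 'M[R]_3) : 'M[R]_3 :=
  \matrix_(i, j) corr (row i P) (row j P).

Definition psdmx (R : realType) (n : nat) (M : 'M[R]_n) : Prop :=
  M^T = M /\ forall v : 'cV[R]_n, 0 <= (v^T *m M *m v) 0 0.

Definition pdmx (R : realType) (n : nat) (M : 'M[R]_n) : Prop :=
  M^T = M /\ forall v : 'cV[R]_n, v != 0 -> 0 < (v^T *m M *m v) 0 0.

Definition corrmx (R : realType) (P : 'M[R]_3) : Prop :=
  psdmx P /\ forall i, P i i = 1.

Definition corrmx_nd (R : realType) (P : 'M[R]_3) : Prop :=
  corrmx P /\ forall i, nonconst (row i P).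

Definition Amx (R : realType) (a b c : R) : 'M[R]_3 :=
  \matrix_(i < 3, j < 3)
    nth 0 (nth [::] [:: [:: 1; a; b];
                        [:: a; 1; c];
                        [:: b; c; 1]] i) j.

Definition H3 (R : realType) : 'M[R]_3 :=
  1%:M - 3%:R^-1 *: (const_mx 1 *m (const_mx 1 : 'cV[R]_3)^T).

(* The library norm on matrices is the sup norm. *)
Definition eucl_norm (R : realType) (v : 'rV[R]_3) : R :=
  Num.sqrt (\sum_k v 0 k ^+ 2).

Definition dnorm (R : realType) (P : 'M[R]_3) (i : 'I_3) : R :=
  eucl_norm (row i P *m H3 R).

Definition Dmx (R : realType) (P : 'M[R]_3) : 'M[R]_3 :=
  diag_mx (\row_i dnorm P i).

(* The right kernel {v | P v = 0}; kermx is the left kernel. *)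
Definition ker (R : realType) (P : 'M[R]_3) : {vspace 'cV[R]_3} :=
  lker (linfun (@mulmx R 3 3 1 P)).

Definition spans_ker (R : realType) (P : 'M[R]_3) (q : 'cV[R]_3) : Prop :=
  q != 0 /\ ker P = <[q]>%VS.

(* Points of the projective plane are lines <[q]> with q != 0.  vpick returns a
   nonzero vector of a nonzero subspace, hence a spanning vector of ker P as
   soon as P has rank two, which is the only case where kappa is meaningful. *)
Definition kappa (R : realType) (P : 'M[R]_3) : {vspace 'cV[R]_3} :=
  <[vpick (ker P)]>%VS.

Definition ssum (R : realType) (q : 'cV[R]_3) : R := \sum_i q i 0.

Definition gram_factor (R : realType) (P : 'M[R]_3) (X : 'M[R]_(3, 2)) : Prop :=
  \rank X = 2%N /\ P = X *m X^T.

Definition Smx (R : realType) (X : 'M[R]_(3, 2)) : 'M[R]_2 :=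
  X^T *m H3 R *m X.

(* Main.v *)
Require Import Defs.
From mathcomp Require Import all_boot all_order all_algebra.
From mathcomp Require Import boolp reals ring lra.

(** Write G = P H P^T for the Gram matrix of the centred rows of P, where H is
    the centring projector.  The squared norms d_i^2 are the diagonal entries of
    G and C(P) = D^-1 G D^-1, so that C(P) is again a correlation matrix, and its
    kernel is the image under D of the kernel of G.

    Suppose s(q) <> 0.  If G v = 0 then H P v = 0, that is, P v = c 1 for some
    scalar c.  Since q is orthogonal to the image of P, pairing with q gives
    c s(q) = 0, hence P v = 0.  Thus ker G = ker P and ker C(P) is spanned by
    D q ([spans_ker_corrmap]).  The same argument applied to X instead of P shows
    that S is positive definite ([Smx_pd]).

    Suppose s(q) = 0.  Then q is also killed by P - 1 1^T, which is symmetric with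
    zero diagonal, so its determinant, twice the product of its off-diagonal
    entries, vanishes.  Hence some off-diagonal entry of P is 1, two rows of P
    coincide, and P = t 1 1^T + (1 - t) e e^T for a nonconstant sign vector e
    ([sum0_sign_mix]).  Every row of P is then an affine image of e, and
    C(P) = e e^T ([corrmap_sign_mix]).  The same fact with t = 0 shows that e e^T
    is a fixed point.

    The identity for d_i^2 - d_j^2 comes from K = X S^-1 X^T.  When s(q) <> 0, the
    forms K and I agree on vectors of sum zero ([leverage_sum0]), while K q = 0.
    Evaluating both forms at e_i - e_j and e_i + e_j - (2 / s(q)) q, both of sum
    zero, gives K_ii - K_jj = - 2 (q_i - q_j) / s(q).  As S is of size 2, S equals
    tr(S) I - det(S) S^-1; with unit diagonal of P this yields
    d_i^2 = tr(S) - det(S) K_ii, and the identity follows.  Since det(S) > 0 it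
    gives the order statement.

    Two Gram factors of P differ by an orthogonal 2 x 2 matrix, hence det(S) does
    not depend on the factor; a factor exists by Cholesky elimination
    ([psd_gram]). *)

Set Implicit Arguments.
Unset Strict Implicit.
Unset Printing Implicit Defensive.

Import Order.TTheory GRing.Theory Num.Theory.
Local Open Scope ring_scope.

(** * Positive semidefinite matrices and Gram factors *)

Lemma quad_tr_mul (R : comRingType) m n (A : 'M[R]_(m, n)) (v : 'cV[R]_n) :
  v^T *m (A^T *m A) *m v = (A *m v)^T *m (A *m v).
Proof. by rewrite trmx_mul !mulmxA. Qed.

Lemma sqnormE (R : comRingType) n (v : 'cV[R]_n) :
  (v^T *m v) 0 0 = \sum_i v i 0 ^+ 2.
Proof. by rewrite mxE; apply: eq_bigr => i _; rewrite mxE expr2. Qed.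

Lemma sqnorm_ge0 (R : realDomainType) n (v : 'cV[R]_n) : 0 <= (v^T *m v) 0 0.
Proof. by rewrite sqnormE sumr_ge0 // => i _; rewrite sqr_ge0. Qed.

Lemma sqnorm_eq0 (R : realDomainType) n (v : 'cV[R]_n) :
  (v^T *m v) 0 0 = 0 -> v = 0.
Proof.
rewrite sqnormE => /eqP; rewrite psumr_eq0; last by move=> i _; rewrite sqr_ge0.
move=> /allP v0; apply/matrixP => i j; rewrite ord1 mxE.
by apply/eqP; rewrite -sqrf_eq0; have /= := v0 i (mem_index_enum i).
Qed.

Lemma sqr_gram_ker (R : realType) m n (A : 'M[R]_(m, n)) (v : 'cV[R]_n) :
  A^T *m A *m v = 0 -> A *m v = 0.
Proof.
by move=> Av; apply: sqnorm_eq0; rewrite -quad_tr_mul -mulmxA Av mulmx0 mxE.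
Qed.

Lemma psd_gram_mul (R : realType) m n (A : 'M[R]_(m, n)) : psdmx (A^T *m A).
Proof.
split; first by rewrite trmx_mul trmxK.
by move=> v; rewrite quad_tr_mul sqnorm_ge0.
Qed.

Lemma bilin_delta (R : comRingType) n (M : 'M[R]_n) (i j : 'I_n) :
  ((delta_mx i 0 : 'cV[R]_n)^T *m M *m (delta_mx j 0 : 'cV[R]_n)) 0 0 = M i j.
Proof. by rewrite trmx_delta -rowE -colE !mxE. Qed.

(** The form is nonnegative along the line v + t (M v), where it equals
    2 t |M v|^2 + t^2 b with b >= 0; for small negative t this would be negative
    unless M v = 0. *)
Lemma psd_ker (R : realType) n (M : 'M[R]_n) (v : 'cV[R]_n) :
  psdmx M -> (v^T *m M *m v) 0 0 = 0 -> M *m v = 0.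
Proof.
move=> [MT Mge] v0; set w := M *m v.
pose a := (w^T *m w) 0 0; pose b := (w^T *m M *m w) 0 0.
have b0 : 0 <= b by exact: Mge.
have a0 : 0 <= a by exact: sqnorm_ge0.
have E t : ((v + t *: w)^T *m M *m (v + t *: w)) 0 0 = 2%:R * t * a + t ^+ 2 * b.
  have vMw : (v^T *m M *m w) 0 0 = a by rewrite /a {2}/w trmx_mul MT.
  have wMv : (w^T *m M *m v) 0 0 = a by rewrite -mulmxA.
  rewrite [(v + _)^T]linearD /= [(t *: w)^T]linearZ /= !mulmxDl !mulmxDr.
  rewrite -!scalemxAl -!scalemxAr.
  move: v0 vMw wMv; rewrite /b !mxE => -> -> ->; ring.
apply: sqnorm_eq0; apply/eqP; rewrite -/w -/a eq_le a0 andbT.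
(* The parameter t = - a / (b + 1) stays meaningful when b = 0. *)
have := Mge (v + (- (b + 1)^-1 * a) *: w); rewrite E.
set c := (b + 1)^-1; have c0 : 0 < c by rewrite invr_gt0; lra.
have bc : b * c = 1 - c by rewrite /c; field; rewrite gt_eqF //; lra.
have -> : 2%:R * (- c * a) * a + (- c * a) ^+ 2 * b = - (a ^+ 2 * (c * (1 + c))).
  have -> : (- c * a) ^+ 2 * b = a ^+ 2 * c * (b * c) by ring.
  rewrite bc; ring.
rewrite oppr_ge0 pmulr_lle0; last by rewrite mulr_gt0 //; lra.
by move=> a2; rewrite -(@ler_pXn2r _ 2) ?nnegrE // expr0n.
Qed.

Lemma psd_congr (R : realType) m n (M : 'M[R]_m) (E : 'M[R]_(m, n)) :
  psdmx M -> psdmx (E^T *m M *m E).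
Proof.
move=> [MT Mge]; split; first by rewrite !trmx_mul trmxK MT mulmxA.
by move=> v; have := Mge (E *m v); rewrite trmx_mul !mulmxA.
Qed.

Lemma psd_diag0 (R : realType) n (M : 'M[R]_n) :
  psdmx M -> (forall i, M i i = 0) -> M = 0.
Proof.
move=> Mp M0; apply/matrixP => i j.
have := psd_ker Mp (v := delta_mx j 0).
by rewrite bilin_delta M0 => /(_ erefl); rewrite -colE => /colP/(_ i); rewrite !mxE.
Qed.

(** Cholesky elimination: subtracting c c^T / M_ii, where c is the i-th column and
    M_ii > 0, leaves a positive semidefinite matrix of strictly smaller rank. *)
Lemma psd_gram (R : realType) n (r : nat) (M : 'M[R]_n) :
  psdmx M -> (\rank M <= r)%N -> exists X : 'M[R]_(n, r), M = X *m X^T.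
Proof.
elim: r M => [|r IH] M Mp.
  rewrite leqn0 mxrank_eq0 => /eqP ->.
  by exists 0; rewrite mul0mx.
move=> rk; have [MT Mge] := Mp.
have [M0|] := boolP [forall i, M i i == 0].
  exists 0; rewrite mul0mx; apply: psd_diag0 => // i.
  by apply/eqP; move/forallP: M0.
rewrite negb_forall => /existsP[i Mii].
have Mi0 : 0 < M i i.
  by rewrite lt_def Mii -bilin_delta Mge.
pose e : 'cV[R]_n := delta_mx i 0.
pose c := col i M; have Ec : M *m e = c by rewrite -colE.
have cT : c^T = e^T *m M by rewrite -Ec trmx_mul MT.
have ec : e^T *m c = (M i i)%:M.
  by apply/matrixP => ? ?; rewrite !ord1 -Ec mulmxA bilin_delta !mxE.
pose N := M - (M i i)^-1 *: (c *m c^T).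
(* N is the congruence of M by I - e c^T / M_ii, hence semidefinite. *)
have NE : N = (1%:M - (M i i)^-1 *: (e *m c^T))^T *m M *m
              (1%:M - (M i i)^-1 *: (e *m c^T)).
  have -> : (1%:M - (M i i)^-1 *: (e *m c^T))^T = 1%:M - (M i i)^-1 *: (c *m e^T).
    by rewrite linearB linearZ /= trmx1 trmx_mul trmxK.
  rewrite mulmxBl mul1mx -scalemxAl -mulmxA -cT.
  rewrite -/N mulmxBr mulmx1 -scalemxAr mulmxA /N mulmxBl Ec -scalemxAl.
  rewrite -(mulmxA c) cT -(mulmxA e^T) Ec ec mul_mx_scalar scalerA mulVf //.
  by rewrite scale1r subrr mul0mx scaler0 subr0.
have Np : psdmx N by rewrite NE; apply: psd_congr.
have Ne : e^T *m N = 0.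
  by rewrite mulmxBr -scalemxAr mulmxA ec -cT mul_scalar_mx scalerA mulVf //
             scale1r subrr.
have rkN : (\rank N <= r)%N.
  rewrite -ltnS; apply: leq_trans rk.
  (* The kernel gains the basis vector e, so the rank drops. *)
  have : (kermx M < kermx N)%MS.
    rewrite ltmxE; apply/andP; split.
      apply/rV_subP => u /sub_kermxP uM; apply/sub_kermxP.
      by rewrite mulmxBr uM -scalemxAr mulmxA -Ec mulmxA uM !mul0mx scaler0 subr0.
    have eN : (e^T <= kermx N)%MS by apply/sub_kermxP.
    apply/negP => /(submx_trans eN)/sub_kermxP eM; move: Mii.
    by rewrite -bilin_delta -/e eM mul0mx mxE eqxx.
  move/rank_ltmx => /=; rewrite !mxrank_ker; rewrite !ltnNge.
  by apply: contra => leMN; rewrite leq_sub2l.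
have [X NX] := IH N Np rkN.
pose y := (Num.sqrt (M i i))^-1 *: c.
suff : exists Z : 'M[R]_(n, 1 + r), M = Z *m Z^T by [].
exists (row_mx y X).
rewrite tr_row_mx mul_row_col -NX /y linearZ /= -scalemxAl -scalemxAr scalerA.
by rewrite -expr2 exprVn sqr_sqrtr ?ltW // /N addrC subrK.
Qed.

(** * Centring and correlation *)

Lemma H3_sym (R : realType) : (H3 R)^T = H3 R.
Proof. by rewrite /H3 linearB linearZ /= trmx1 trmx_mul trmxK. Qed.

Lemma ssumE (R : realType) (v : 'cV[R]_3) : ssum v = v 0 0 + v 1 0 + v (1 + 1) 0.
Proof.
rewrite /ssum !big_ord_recl big_ord0 addr0 addrA.
by congr (v _ 0 + v _ 0 + v _ 0); apply: val_inj.
Qed.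

Lemma ssumD (R : realType) (u v : 'cV[R]_3) : ssum (u + v) = ssum u + ssum v.
Proof. by rewrite /ssum -big_split; apply: eq_bigr => i _; rewrite mxE. Qed.

Lemma ssumZ (R : realType) a (v : 'cV[R]_3) : ssum (a *: v) = a * ssum v.
Proof. by rewrite /ssum mulr_sumr; apply: eq_bigr => i _; rewrite mxE. Qed.

Lemma ssumN (R : realType) (v : 'cV[R]_3) : ssum (- v) = - ssum v.
Proof. by rewrite -scaleN1r ssumZ mulN1r. Qed.

Lemma ssum_delta (R : realType) i : ssum (delta_mx i 0 : 'cV[R]_3) = 1.
Proof.
rewrite /ssum (bigD1 i) //= mxE !eqxx big1 ?addr0 // => j /negPf ji.
by rewrite mxE ji.
Qed.

Lemma H3_mulE (R : realType) (v : 'cV[R]_3) :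
  H3 R *m v = v - const_mx (ssum v / 3%:R).
Proof.
rewrite /H3 mulmxBl mul1mx -scalemxAl -mulmxA; congr (_ - _).
apply/matrixP => i j; rewrite !mxE big_ord1 !mxE mul1r mulrC; congr (_ * _).
by apply: eq_bigr => k _; rewrite !mxE mul1r ord1.
Qed.

Lemma ssum_H3 (R : realType) (v : 'cV[R]_3) : ssum (H3 R *m v) = 0.
Proof. by rewrite H3_mulE [LHS]ssumE !mxE [ssum v]ssumE; field. Qed.

Lemma H3_fix (R : realType) (v : 'cV[R]_3) : ssum v = 0 -> H3 R *m v = v.
Proof. by rewrite H3_mulE => ->; apply/matrixP => i j; rewrite !mxE mul0r subr0. Qed.

Lemma H3_idem (R : realType) : H3 R *m H3 R = H3 R.
Proof.
apply/matrixP => i j; have := H3_fix (ssum_H3 (delta_mx j 0 : 'cV[R]_3)).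
by rewrite mulmxA -!colE => /colP/(_ i); rewrite ![col _ _ _ _]mxE.
Qed.

Lemma H3_ker (R : realType) (v : 'cV[R]_3) :
  H3 R *m v = 0 -> v = const_mx (ssum v / 3%:R).
Proof. by rewrite H3_mulE => /eqP; rewrite subr_eq0 => /eqP. Qed.

Lemma centredE (R : realType) (x : 'rV[R]_3) k : (x *m H3 R) 0 k = x 0 k - mean x.
Proof.
rewrite -[x *m _]trmxK trmx_mul H3_sym H3_mulE !mxE; congr (_ - _ / _).
by apply: eq_bigr => i _; rewrite mxE.
Qed.

Lemma centred_normE (R : realType) (x : 'rV[R]_3) :
  eucl_norm (x *m H3 R) = Num.sqrt (\sum_k (x 0 k - mean x) ^+ 2).
Proof. by congr Num.sqrt; apply: eq_bigr => k _; rewrite centredE. Qed.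

Lemma corrE (R : realType) (x y : 'rV[R]_3) :
  corr x y = (x *m H3 R *m y^T) 0 0 / (eucl_norm (x *m H3 R) * eucl_norm (y *m H3 R)).
Proof.
rewrite !centred_normE -sqrtrM ?sumr_ge0 // => [|k _]; last exact: sqr_ge0.
congr (_ / _); rewrite -H3_idem mulmxA -mulmxA -{2}H3_sym -trmx_mul mxE.
by apply: eq_bigr => k _; rewrite [(_ *m _)^T _ _]mxE !centredE.
Qed.

Lemma centred_norm_gt0 (R : realType) (x : 'rV[R]_3) :
  nonconst x -> 0 < eucl_norm (x *m H3 R).
Proof.
move=> [k [l neq]]; rewrite sqrtr_gt0 lt_def sumr_ge0 ?andbT => [|i _];
  last exact: sqr_ge0.
apply: contra neq; rewrite psumr_eq0 => [/allP x0|i _]; last exact: sqr_ge0.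
have xm i : x 0 i = mean x.
  apply/eqP; rewrite -subr_eq0 -centredE -sqrf_eq0.
  by have /= := x0 i (mem_index_enum i).
by rewrite !xm.
Qed.

(** The Gram matrix of the centred rows: one factor H suffices, H being a
    symmetric idempotent. *)
Definition centred_gram (R : realType) (P : 'M[R]_3) := P *m H3 R *m P^T.

Lemma centred_gramE (R : realType) (P : 'M[R]_3) :
  centred_gram P = (H3 R *m P^T)^T *m (H3 R *m P^T).
Proof. by rewrite trmx_mul trmxK H3_sym mulmxA -(mulmxA P) H3_idem. Qed.

Lemma dnorm_sqr (R : realType) (P : 'M[R]_3) i :
  dnorm P i ^+ 2 = centred_gram P i i.
Proof.
rewrite /dnorm sqr_sqrtr ?sumr_ge0 // => [|k _]; last exact: sqr_ge0.
rewrite centred_gramE mxE; apply: eq_bigr => k _.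
rewrite trmx_mul trmxK H3_sym -row_mul expr2.
by rewrite -[H3 R *m _]trmxK trmx_mul trmxK H3_sym !mxE.
Qed.

Lemma dnorm_nonconst_gt0 (R : realType) (P : 'M[R]_3) i :
  nonconst (row i P) -> 0 < dnorm P i.
Proof. exact: centred_norm_gt0. Qed.

Lemma corrmapE (R : realType) (P : 'M[R]_3) i j :
  corrmap P i j = centred_gram P i j / (dnorm P i * dnorm P j).
Proof.
rewrite mxE corrE tr_row -/(dnorm P i) -/(dnorm P j) -row_mul; congr (_ / _).
by rewrite mxE [RHS]mxE; apply: eq_bigr => k _;
  rewrite [row _ _ _ _]mxE [col _ _ _ _]mxE.
Qed.

(** The congruence C(P) = D^-1 G D^-1; as a congruence it preserves positive
    semidefiniteness. *)
Lemma corrmap_congr (R : realType) (P : 'M[R]_3)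
    (E := diag_mx (\row_i (dnorm P i)^-1)) :
  corrmap P = E *m centred_gram P *m E.
Proof.
apply/matrixP => i j; rewrite corrmapE /E; move: (centred_gram P) => G.
by rewrite mul_mx_diag mxE mul_diag_mx !mxE invfM; ring.
Qed.

Lemma corrmx_corrmap (R : realType) (P : 'M[R]_3) :
  (forall i, nonconst (row i P)) -> corrmx (corrmap P).
Proof.
move=> ncP; split; last first.
  move=> i; rewrite corrmapE -dnorm_sqr -expr2 divff //.
  by rewrite expf_neq0 // gt_eqF // dnorm_nonconst_gt0.
rewrite corrmap_congr; set E := diag_mx _.
rewrite -{1}[E]tr_diag_mx; apply: psd_congr.
by rewrite centred_gramE; apply: psd_gram_mul.
Qed.

Lemma corrmap_ker (R : realType) (P : 'M[R]_3) (v : 'cV[R]_3) :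
  (forall i, nonconst (row i P)) ->
  corrmap P *m (Dmx P *m v) = 0 <-> centred_gram P *m v = 0.
Proof.
move=> ncP; have d0 i : dnorm P i != 0 by rewrite gt_eqF // dnorm_nonconst_gt0.
rewrite corrmap_congr; move: (centred_gram P) => G; set E := diag_mx _.
have ED : E *m Dmx P = 1%:M.
  apply/matrixP => i j; rewrite mul_mx_diag !mxE mulrnAl.
  by case: eqP => // ->; rewrite mulVf.
have DE : Dmx P *m E = 1%:M by apply: mulmx1C.
rewrite -!mulmxA (mulmxA E (Dmx P)) ED mul1mx; split => [EG|->]; last by rewrite mulmx0.
by rewrite -[_ *m v]mul1mx -DE -mulmxA EG mulmx0.
Qed.

Lemma spans_kerP (R : realType) (P : 'M[R]_3) (q : 'cV[R]_3) :
  spans_ker P q <->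
  q != 0 /\ forall v, P *m v = 0 <-> exists c, v = c *: q.
Proof.
have kerE v : (v \in ker P) = (P *m v == 0) by rewrite memv_ker lfunE.
split=> -[q0 kq]; split=> //.
  move=> v; apply: (iff_trans (B := v \in ker P)).
    by rewrite kerE; split => /eqP.
  by rewrite kq; split => /vlineP.
apply/vspaceP => v; rewrite kerE.
by apply/eqP/vlineP => /kq.
Qed.

Lemma spans_ker_mul0 (R : realType) (P : 'M[R]_3) (q : 'cV[R]_3) :
  spans_ker P q -> P *m q = 0.
Proof. by move=> /spans_kerP[_ ->]; exists 1; rewrite scale1r. Qed.

Lemma spans_kerN (R : realType) (P : 'M[R]_3) (q : 'cV[R]_3) :
  spans_ker P q -> spans_ker P (- q).
Proof.
move=> /spans_kerP[q0 kq]; apply/spans_kerP; split; first by rewrite oppr_eq0.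
by move=> v; rewrite kq; split=> -[c ->]; exists (- c); rewrite ?scalerN scaleNr ?opprK.
Qed.

Lemma spans_ker_kappa (R : realType) (P : 'M[R]_3) (q : 'cV[R]_3) :
  spans_ker P q -> kappa P = <[q]>%VS.
Proof.
move=> [q0 kq]; rewrite /kappa kq.
have /vlineP[c E] := memv_pick <[q]>%VS.
have c0 : c != 0.
  apply: contraNneq q0 => c0; move: E; rewrite c0 scale0r => /eqP.
  by rewrite vpick0 -memv0 => /eqP <-; rewrite memv_line.
rewrite E; apply: subv_anti; rewrite -!memvE memvZ ?memv_line //=.
by rewrite -{1}[q](scalerK c0) memvZ ?memv_line.
Qed.

(** The centring projector kills only constant vectors, and a vector q of nonzero
    coordinate sum that is orthogonal to the image of A keeps nonzero constants
    out of that image. *)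
Lemma centring_inj (R : realType) n (A : 'M[R]_(3, n)) (q : 'cV[R]_3) (v : 'cV[R]_n) :
  q^T *m A = 0 -> ssum q != 0 -> H3 R *m (A *m v) = 0 -> A *m v = 0.
Proof.
move=> qA s0 /H3_ker Av; have : q^T *m (A *m v) = 0 by rewrite mulmxA qA mul0mx.
rewrite Av => /matrixP/(_ 0 0); rewrite !mxE.
have -> : forall c : R, \sum_j q^T 0 j * const_mx (m := 3) (n := 1) c j 0 = ssum q * c.
  by move=> c; rewrite /ssum mulr_suml; apply: eq_bigr => j _; rewrite !mxE.
move/eqP; rewrite mulf_eq0 (negPf s0) /= => /eqP ->.
by apply/matrixP => i j; rewrite !mxE.
Qed.

Lemma ker_centred_gram (R : realType) (P : 'M[R]_3) (q v : 'cV[R]_3) :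
  P^T = P -> P *m q = 0 -> ssum q != 0 ->
  centred_gram P *m v = 0 <-> P *m v = 0.
Proof.
move=> PT Pq s0; split; last by rewrite /centred_gram PT -mulmxA => ->; rewrite mulmx0.
rewrite centred_gramE PT => /sqr_gram_ker; rewrite -mulmxA.
by apply: centring_inj s0; rewrite -PT -trmx_mul Pq trmx0.
Qed.

(** D^-1 turns ker C(P) into ker (P H P), which is ker P by [ker_centred_gram]. *)
Lemma spans_ker_corrmap (R : realType) (P : 'M[R]_3) (q : 'cV[R]_3) :
  P^T = P -> (forall i, nonconst (row i P)) -> spans_ker P q -> ssum q != 0 ->
  spans_ker (corrmap P) (Dmx P *m q).
Proof.
move=> PT ncP Hq s0; have Pq := spans_ker_mul0 Hq.
have /spans_kerP[q0 kq] := Hq.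
have d0 i : dnorm P i != 0 by rewrite gt_eqF // dnorm_nonconst_gt0.
have DE : Dmx P \in unitmx.
  by rewrite unitmxE det_diag unitfE; apply/prodf_neq0 => i _; rewrite mxE.
apply/spans_kerP; split.
  by apply: contraNneq q0 => Dq; rewrite -[q](mulKmx DE) Dq mulmx0.
move=> v; rewrite -[v in corrmap P *m v](mulKVmx DE) corrmap_ker //.
rewrite (ker_centred_gram _ PT Pq s0) kq.
split=> -[c E]; exists c; first by rewrite scalemxAr -E mulKVmx.
by rewrite E -scalemxAr mulKmx.
Qed.

Lemma rank_spans_ker (R : realType) (P : 'M[R]_3) (q : 'cV[R]_3) :
  P^T = P -> spans_ker P q -> \rank P = 2.
Proof.
move=> PT Hq; have Pq := spans_ker_mul0 Hq; have /spans_kerP[q0 kq] := Hq.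
have : \rank (kermx P) = 1.
  suff -> : \rank (kermx P) = \rank q^T by rewrite rank_rV -trmx0 (inj_eq trmx_inj) q0.
  apply/eqmx_rank/andP; split.
    apply/rV_subP => u /sub_kermxP uP.
    have /kq[c uc] : P *m u^T = 0 by rewrite -{1}PT -trmx_mul uP trmx0.
    by rewrite -[u]trmxK uc linearZ /= scalemx_sub.
  by apply/sub_kermxP; rewrite -PT -trmx_mul Pq trmx0.
rewrite mxrank_ker; have := rank_leq_row P.
by case: (\rank P) => [|[|[|[|]]]].
Qed.

(** A constant row i has all entries 1, its diagonal entry.  The quadratic form of
    C then vanishes at e_i - e_j, so columns i and j of C agree for every j. *)
Lemma corrmx_const_row (R : realType) (C : 'M[R]_3) i :
  corrmx C -> ~ nonconst (row i C) -> C = const_mx 1.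
Proof.
move=> [Cp C1] nc; have [CT _] := Cp.
have row1 j : C i j = 1.
  rewrite -(C1 i); apply/eqP/negP => neq; apply: nc.
  by exists j, i; rewrite !mxE; apply/negP.
apply/matrixP => k j; rewrite mxE.
have := psd_ker Cp (v := delta_mx i 0 - delta_mx j 0).
rewrite [(_ - _)^T]linearB /= !mulmxBl !mulmxBr => kerC.
have : C *m (delta_mx i 0 - delta_mx j 0 : 'cV_3) = 0.
  rewrite mulmxBr; apply: kerC.
  have eii := bilin_delta C i i; have eij := bilin_delta C i j.
  have eji := bilin_delta C j i; have ejj := bilin_delta C j j.
  have Cji : C j i = 1 by rewrite -CT mxE row1.
  rewrite !C1 in eii ejj; rewrite {}row1 in eij; rewrite {}Cji in eji.
  move: eii eij eji ejj; do 4! move: (_ *m _ *m _) => ?.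
  rewrite !mxE => -> -> -> ->; ring.
rewrite mulmxBr -!colE => /colP/(_ k); rewrite !mxE.
rewrite -{1}CT mxE row1 => /eqP; rewrite subr_eq0 => /eqP <- //.
Qed.

(** The all-ones matrix, the only degenerate correlation matrix, has rank one. *)
Lemma corrmx_nd_rank (R : realType) (C : 'M[R]_3) :
  corrmx C -> \rank C = 2 -> corrmx_nd C.
Proof.
move=> Cc rkC; split=> // i; apply: boolp.contrapT => /(corrmx_const_row Cc) C1.
have : (\rank C <= 1)%N.
  rewrite C1 -[const_mx 1](_ : (const_mx 1 : 'cV[R]_3) *m const_mx 1 = _).
    by rewrite mulmx_max_rank.
  by apply/matrixP => k j; rewrite !mxE big_ord1 !mxE mulr1.
by rewrite rkC.
Qed.

(** * Kernels of coordinate sum zero *)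

Lemma corr_affine (R : realType) (w : 'rV[R]_3) (a b c d : R) :
  nonconst w ->
  corr (const_mx c + a *: w) (const_mx d + b *: w) = Num.sg (a * b).
Proof.
move=> ncw; pose V := \sum_k (w 0 k - mean w) ^+ 2.
have V0 : V > 0 by rewrite -sqrtr_gt0 -centred_normE centred_norm_gt0.
have cen e f k :
    (const_mx e + f *: w) 0 k - mean (const_mx e + f *: w) = f * (w 0 k - mean w).
  by rewrite /mean !big_ord_recl !big_ord0 !mxE; field.
pose x := const_mx c + a *: w; pose y := const_mx d + b *: w.
have num : \sum_k (x 0 k - mean x) * (y 0 k - mean y) = a * b * V.
  by rewrite mulr_sumr; apply: eq_bigr => k _; rewrite !cen; ring.
have var e f (z := const_mx e + f *: w) : \sum_k (z 0 k - mean z) ^+ 2 = f * f * V.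
  by rewrite mulr_sumr; apply: eq_bigr => k _; rewrite cen; ring.
rewrite /corr num !var.
have -> : a * a * V * (b * b * V) = (a * b * V) ^+ 2 by ring.
rewrite sqrtr_sqr normrM (gtr0_norm V0) -mulf_div divff ?gt_eqF // mulr1.
have [->|ab0] := eqVneq (a * b) 0; first by rewrite mul0r sgr0.
by rewrite {1}[a * b]numEsg mulfK // normr_eq0.
Qed.

(** For a nonconstant sign vector e these are the matrices [Amx 1 t' t'],
    [Amx t' 1 t'] and [Amx t' t' 1] with t' = 2 t - 1; in this form each row is
    visibly an affine image of e. *)
Definition sign_mix (R : realType) (t : R) (e : 'cV[R]_3) : 'M[R]_3 :=
  const_mx t + (1 - t) *: (e *m e^T).

Lemma sgr_of_sqr1 (R : realType) (x : R) : x ^+ 2 = 1 -> Num.sg x = x.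
Proof. by move/eqP; rewrite sqrf_eq1 => /orP[] /eqP ->; rewrite ?sgrN sgr1. Qed.

(** Correlation is invariant under affine changes up to sign, and the sign of
    1 - t enters twice. *)
Lemma corrmap_sign_mix (R : realType) (t : R) (e : 'cV[R]_3) :
  t != 1 -> (forall i, e i 0 ^+ 2 = 1) -> nonconst e^T ->
  corrmap (sign_mix t e) = e *m e^T.
Proof.
move=> t1 e1 nce; apply/matrixP => i j; rewrite mxE.
have rowE k : row k (sign_mix t e) = const_mx t + ((1 - t) * e k 0) *: e^T.
  by apply/rowP => l; rewrite !mxE big_ord1 !mxE mulrA.
rewrite !rowE corr_affine // mulrACA !sgrM !(sgr_of_sqr1 (e1 _)) -expr2 sqr_sg.
by rewrite subr_eq0 eq_sym t1 mul1r mxE big_ord1 mxE.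
Qed.

(** The matrix e e^T is itself a sign mix, with t = 0. *)
Lemma sign_fixed (R : realType) (e : 'cV[R]_3) (C := e *m e^T) :
  (forall i, e i 0 ^+ 2 = 1) -> nonconst e^T ->
  [/\ corrmx_nd C, \rank C = 1%N & corrmap C = C].
Proof.
move=> e1 nce; have CE i j : C i j = e i 0 * e j 0 by rewrite mxE big_ord1 mxE.
have mixE : C = sign_mix 0 e.
  by apply/matrixP => i j; rewrite !mxE subr0 mul1r add0r.
have fixC : corrmap C = C by rewrite {1}mixE corrmap_sign_mix // eq_sym oner_eq0.
have ncC i : nonconst (row i C).
  have [k [l kl]] := nce; exists k, l; rewrite ![row _ _ _ _]mxE !CE.
  move: kl; rewrite !mxE; apply: contraNneq => /mulfI -> //.
  by rewrite -sqrf_eq0 e1 oner_eq0.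
split=> //; first by split=> //; rewrite -fixC; apply: corrmx_corrmap.
apply/eqP; rewrite eqn_leq mulmx_max_rank /= lt0n mxrank_eq0.
apply/eqP => /matrixP/(_ 0 0)/eqP; rewrite CE -expr2 e1 mxE.
by rewrite oner_eq0.
Qed.

Lemma ord3_forall (p : 'I_3 -> Prop) : p 0 -> p 1 -> p (1 + 1) -> forall i, p i.
Proof.
move=> p0 p1 p2 [[|[|[|//]]] Hi].
- by rewrite (_ : Ordinal Hi = 0) //; apply: val_inj.
- by rewrite (_ : Ordinal Hi = 1) //; apply: val_inj.
by rewrite (_ : Ordinal Hi = 1 + 1) //; apply: val_inj.
Qed.

Lemma unit_diag_Amx (R : realType) (P : 'M[R]_3) :
  P^T = P -> (forall i, P i i = 1) -> P = Amx (P 0 1) (P 0 (1 + 1)) (P 1 (1 + 1)).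
Proof.
move=> PT P1; have sym i j : P j i = P i j by rewrite -{1}PT mxE.
by apply/matrixP; do 2 ! [apply: ord3_forall]; rewrite mxE /= ?P1 // sym.
Qed.

(** The equations say that (x, y, z) is in the kernel of the symmetric matrix with
    zero diagonal and off-diagonal entries a, b, c.  Its determinant is 2 a b c, so
    one entry vanishes; the vanishing sum of x, y, z makes the other two equal. *)
Lemma zero_diag_sum0_kernel (F : realFieldType) (a b c x y z : F) :
  [|| x != 0, y != 0 | z != 0] -> x + y + z = 0 ->
  a * y + b * z = 0 -> a * x + c * z = 0 -> b * x + c * y = 0 ->
  [\/ a = 0 /\ b = c, b = 0 /\ a = c | c = 0 /\ a = b].
Proof.
move=> nz sum e1 e2 e3.
have eq0 (u v : F) : v != 0 -> u * v = 0 -> u = 0.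
  by move=> /negPf v0 /eqP; rewrite mulf_eq0 v0 orbF => /eqP.
have : b * c * z = 0.
  have -> : b * c * z = (c * (a * y + b * z) + b * (a * x + c * z)
                         - a * (b * x + c * y)) / 2%:R.
    by field.
  by rewrite e1 e2 e3; ring.
have [z0 _|z0 /(eq0 _ _ z0)/eqP] := eqVneq z 0.
  have xy : y = - x by lra.
  have x0 : x != 0 by move: nz; rewrite z0 xy oppr_eq0 eqxx orbF orbb.
  constructor 1; split; [|apply/subr0_eq]; apply: eq0 x0 _;
    by move: e1 e2 e3; rewrite xy z0; lra.
rewrite mulf_eq0 => /orP[] /eqP h0; rewrite h0 in e1 e2 e3 *.
  have [y0|y0] := eqVneq y 0.
    have xz : x = - z by lra.
    constructor 2; split=> //; apply/subr0_eq; apply: eq0 z0 _.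
    by move: e2; rewrite xz; lra.
  have ay : a * y = 0 by lra.
  have cy : c * y = 0 by lra.
  by constructor 2; rewrite (eq0 _ _ y0 ay) (eq0 _ _ y0 cy).
have [x0|x0] := eqVneq x 0.
  have yz : y = - z by lra.
  constructor 3; split=> //; apply/esym/subr0_eq; apply: eq0 z0 _.
  by move: e1; rewrite yz; lra.
have ax : a * x = 0 by lra.
have bx : b * x = 0 by lra.
by constructor 3; rewrite (eq0 _ _ x0 ax) (eq0 _ _ x0 bx).
Qed.

(** Since q has sum zero, it is also in the kernel of 1 1^T - P, whose diagonal is
    zero; [zero_diag_sum0_kernel] then forces two rows of P to coincide. *)
Lemma sum0_sign_mix (R : realType) (P : 'M[R]_3) (q : 'cV[R]_3) :
  P^T = P -> (forall i, P i i = 1) -> nonconst (row 0 P) ->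
  q != 0 -> P *m q = 0 -> ssum q = 0 ->
  exists t e, [/\ t != 1, P = sign_mix t e, forall i, e i 0 ^+ 2 = 1, nonconst e^T &
    e *m e^T = Amx 1 (-1) (-1) \/ e *m e^T = Amx (-1) 1 (-1) \/
    e *m e^T = Amx (-1) (-1) 1].
Proof.
move=> PT P1 nc q0 Pq sq; have sym i j : P j i = P i j by rewrite -{1}PT mxE.
have row_eq i : P i 0 * q 0 0 + P i 1 * q 1 0 + P i (1 + 1) * q (1 + 1) 0 = 0.
  have := ssumE (\col_k (P i k * q k 0)); rewrite !mxE => <-.
  move: Pq => /matrixP/(_ i 0); rewrite !mxE => <-.
  by apply: eq_bigr => k _; rewrite mxE.
have PA := unit_diag_Amx PT P1.
set a := P 0 1 in PA; set b := P 0 (1 + 1) in PA; set c := P 1 (1 + 1) in PA.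
have := row_eq 0; have := row_eq 1; have := row_eq (1 + 1).
rewrite !P1 (sym 0 1) (sym 0 (1 + 1)) (sym 1 (1 + 1)) -/a -/b -/c.
move: sq; rewrite ssumE => sq r2 r1 r0.
have nz : [|| q 0 0 != 0, q 1 0 != 0 | q (1 + 1) 0 != 0].
  apply: contraNT q0; rewrite !negb_or !negbK => /and3P[/eqP q00 /eqP q10 /eqP q20].
  by apply/eqP/matrixP => i j; rewrite ord1 mxE; move: i; apply: ord3_forall.
have nones : Amx (P 0 1) (P 0 (1 + 1)) (P 1 (1 + 1)) <> Amx 1 1 1.
  rewrite -PA => P111; case: nc => k [l]; rewrite P111 !mxE /=.
  by case: k l => [[|[|[|//]]] ?] [[|[|[|//]]] ?] /=; rewrite eqxx.
(* The sign vector singling out i, the index of the row left over. *)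
pose s (i : 'I_3) : 'cV[R]_3 := \col_k (if k == i then -1 else 1).
have s1 i k : s i k 0 ^+ 2 = 1 by rewrite mxE; case: ifP; rewrite ?sqrrN expr1n.
have snc i : nonconst (s i)^T.
  exists i, (i + 1); rewrite !mxE eqxx (_ : (i + 1 == i) = false).
    by apply/eqP; lra.
  by move: i; apply: ord3_forall.
have ssT i : s i *m (s i)^T = \matrix_(k, l) if (k == i) == (l == i) then 1 else -1.
  by apply/matrixP => k l; rewrite !mxE big_ord1 !mxE; do 2 ! case: ifP => _ /=; ring.
have mixE v i : sign_mix ((1 + v) / 2%:R) (s i) =
    \matrix_(k, l) if (k == i) == (l == i) then 1 else v.
  by apply/matrixP => k l; rewrite /sign_mix ssT !mxE; case: ifP => _; field.
have A2 (v : R) : Amx 1 v v =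
    \matrix_(k, l) if (k == 1 + 1) == (l == 1 + 1) then 1 else v.
  by apply/matrixP; do 2 ! [apply: ord3_forall]; rewrite !mxE.
have A1 (v : R) : Amx v 1 v = \matrix_(k, l) if (k == 1) == (l == 1) then 1 else v.
  by apply/matrixP; do 2 ! [apply: ord3_forall]; rewrite !mxE.
have A0 (v : R) : Amx v v 1 = \matrix_(k, l) if (k == 0) == (l == 0) then 1 else v.
  by apply/matrixP; do 2 ! [apply: ord3_forall]; rewrite !mxE.
have t1 (v : R) : v != 1 -> (1 + v) / 2%:R != 1.
  by apply: contra => /eqP tv; apply/eqP; lra.
have [|||[a1 bc]|[b1 ac]|[c1 ab]] :=
  zero_diag_sum0_kernel (a := 1 - a) (b := 1 - b) (c := 1 - c) nz sq.
- lra.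
- lra.
- lra.
- have {}bc : b = c by lra.
  have {}a1 : a = 1 by lra.
  exists ((1 + c) / 2%:R), (s (1 + 1)); rewrite mixE PA a1 bc A2 ssT -(A2 (-1)).
  split=> //; last by left.
  by apply: t1; apply/eqP => c1; apply: nones; rewrite -/a -/b -/c a1 bc c1.
- have {}ac : a = c by lra.
  have {}b1 : b = 1 by lra.
  exists ((1 + c) / 2%:R), (s 1); rewrite mixE PA b1 ac A1 ssT -(A1 (-1)).
  split=> //; last by right; left.
  by apply: t1; apply/eqP => c1; apply: nones; rewrite -/a -/b -/c b1 ac c1.
have {}ab : a = b by lra.
have {}c1 : c = 1 by lra.
exists ((1 + b) / 2%:R), (s 0); rewrite mixE PA c1 ab A0 ssT -(A0 (-1)).
split=> //; last by right; right.
by apply: t1; apply/eqP => b1; apply: nones; rewrite -/a -/b -/c c1 ab b1.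
Qed.

(** * The reduced matrix S and the leverage form *)

Lemma ord2_forall (p : 'I_2 -> Prop) : p 0 -> p 1 -> forall i, p i.
Proof.
move=> p0 p1 [[|[|//]] Hi].
- by rewrite (_ : Ordinal Hi = 0) //; apply: val_inj.
by rewrite (_ : Ordinal Hi = 1) //; apply: val_inj.
Qed.

Lemma mxtrace2 (R : comRingType) (A : 'M[R]_2) : \tr A = A 0 0 + A 1 1.
Proof.
rewrite /mxtrace !big_ord_recl big_ord0 addr0.
by congr (_ + A _ _); apply: val_inj.
Qed.

(** Cayley-Hamilton in size two. *)
Lemma adj_mx2 (R : comRingType) (A : 'M[R]_2) : \adj A = (\tr A)%:M - A.
Proof.
have E i j : \adj A i j = (-1) ^+ (j + i) * A (lift j 0) (lift i 0).
  by rewrite mxE /cofactor [row' _ _]mx11_scalar det_scalar1 !mxE.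
have l0 : lift (0 : 'I_2) 0 = 1 by apply: val_inj.
have l1 : lift (1 : 'I_2) 0 = 0 by apply: val_inj.
apply/matrixP; do 2 ! [apply: ord2_forall]; rewrite E ?l0 ?l1 mxtrace2 !mxE /=; ring.
Qed.

(** The form of A at (adj A) e_1 is det(A) times a diagonal entry of adj(A), which
    is A_00 > 0. *)
Lemma pd_det_gt0 (R : realType) (A : 'M[R]_2) : pdmx A -> 0 < \det A.
Proof.
move=> [AT Apos].
have A00 : 0 < A 0 0.
  rewrite -bilin_delta; apply: Apos; apply/eqP => /matrixP/(_ 0 0)/eqP.
  by rewrite !mxE oner_eq0.
have /Apos : \adj A *m (delta_mx 1 0 : 'cV_2) != 0.
  rewrite -colE; apply/eqP => /matrixP/(_ 1 0)/eqP.
  by rewrite mxE adj_mx2 mxtrace2 !mxE /= mulr1n addrK gt_eqF.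
rewrite -mulmxA (mulmxA A) mul_mx_adj mul_scalar_mx -scalemxAr trmx_mul.
rewrite adj_mx2 [(_ - _)^T]linearB /= tr_scalar_mx AT -adj_mx2 mxE bilin_delta.
by rewrite adj_mx2 mxtrace2 !mxE /= mulr1n addrK pmulr_lgt0.
Qed.

Lemma gram_factor_ker (R : realType) (P : 'M[R]_3) (X : 'M[R]_(3, 2)) (q : 'cV[R]_3) :
  gram_factor P X -> P *m q = 0 -> X^T *m q = 0.
Proof. by move=> [_ ->] Xq; apply: sqr_gram_ker; rewrite trmxK. Qed.

(** S is the Gram matrix of H X, and H X is injective by [centring_inj]. *)
Lemma Smx_pd (R : realType) (P : 'M[R]_3) (X : 'M[R]_(3, 2)) (q : 'cV[R]_3) :
  gram_factor P X -> P *m q = 0 -> ssum q != 0 -> pdmx (Smx X).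
Proof.
move=> PX Pq s0; have [rkX _] := PX.
have SE : Smx X = (H3 R *m X)^T *m (H3 R *m X).
  by rewrite trmx_mul H3_sym mulmxA -(mulmxA X^T) H3_idem.
have [ST Sge] := psd_gram_mul (H3 R *m X); rewrite -SE in ST Sge.
split=> // v v0; rewrite lt_def Sge andbT; apply: contra v0 => /eqP.
rewrite SE quad_tr_mul => /sqnorm_eq0; rewrite -mulmxA => /centring_inj Xv.
have {}Xv : X *m v = 0.
  by apply: Xv s0; rewrite -[X]trmxK -trmx_mul (gram_factor_ker PX Pq) trmx0.
have fX : row_free X^T by rewrite -row_leq_rank mxrank_tr rkX.
apply/eqP/trmx_inj/(row_free_inj fX).
by rewrite -trmx_mul Xv !trmx0 mul0mx.
Qed.

(** Both factors have the column space of P, so X = Y Q, and X X^T = Y Y^T makes Q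
    orthogonal; S is then changed by an orthogonal congruence. *)
Lemma det_Smx_unique (R : realType) (P : 'M[R]_3) (X Y : 'M[R]_(3, 2)) :
  \rank P = 2%N -> gram_factor P X -> gram_factor P Y -> \det (Smx X) = \det (Smx Y).
Proof.
move=> rkP [rkX PX] [rkY PY].
have [Q XQ] : exists Q : 'M_2, X = Y *m Q.
  have XY : (X^T <= Y^T)%MS.
    have sX : (P <= X^T)%MS by rewrite PX submxMl.
    have sY : (P <= Y^T)%MS by rewrite PY submxMl.
    apply: submx_trans sY.
    by rewrite -(geq_leqif (mxrank_leqif_sup sX)) mxrank_tr rkX rkP.
  by have /submxP[D E] := XY; exists D^T; rewrite -[X]trmxK E trmx_mul trmxK.
have fY : row_free Y^T by rewrite -row_leq_rank mxrank_tr rkY.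
have QQ : Q *m Q^T = 1%:M.
  apply: (row_free_inj fY); rewrite mul1mx; apply: trmx_inj; apply: (row_free_inj fY).
  rewrite !trmx_mul !trmxK -!mulmxA.
  by rewrite mulmxA -PY PX XQ trmx_mul !mulmxA.
have -> : Smx X = Q^T *m Smx Y *m Q by rewrite /Smx XQ trmx_mul !mulmxA.
have dQ : \det Q * \det Q = 1 by rewrite -{2}det_tr -det_mulmx QQ det1.
by rewrite !det_mulmx det_tr mulrAC dQ mul1r.
Qed.

(** The leverage (hat) matrix of the centred factor H X, except that its outer
    factors are left uncentred: this makes it kill ker P. *)
Definition leverage (R : realType) (X : 'M[R]_(3, 2)) : 'M[R]_3 :=
  X *m invmx (Smx X) *m X^T.

(** Put y = K f - f with K the leverage matrix.  Then X^T H y = 0 because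
    X^T H X S^-1 = I, so H y is in ker P; it has sum zero while q has not, hence
    H y = 0, and y is orthogonal to every vector of sum zero. *)
Lemma leverage_sum0 (R : realType) (P : 'M[R]_3) (X : 'M[R]_(3, 2))
    (q f p : 'cV[R]_3) :
  gram_factor P X -> spans_ker P q -> ssum q != 0 ->
  ssum f = 0 -> ssum p = 0 -> p^T *m leverage X *m f = p^T *m f.
Proof.
move=> PX kq s0 f0 p0; have Pq := spans_ker_mul0 kq; have /spans_kerP[q0 kerq] := kq.
have uS : Smx X \in unitmx.
  by rewrite unitmxE unitfE gt_eqF // pd_det_gt0 //; apply: Smx_pd PX Pq s0.
pose y := leverage X *m f - f.
have XHy : X^T *m (H3 R *m y) = 0.
  rewrite /y !mulmxBr (H3_fix f0) /leverage !mulmxA -/(Smx X) mulmxV // mul1mx.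
  by rewrite subrr.
have [|c Hy] := (kerq (H3 R *m y)).1.
  by case: PX => _ ->; rewrite -mulmxA XHy mulmx0.
have c0 : c = 0.
  have := ssum_H3 y; rewrite Hy ssumZ => /eqP.
  by rewrite mulf_eq0 (negPf s0) orbF => /eqP.
apply/eqP; rewrite -subr_eq0 -mulmxA -mulmxBr -/y.
by rewrite -{1}(H3_fix p0) trmx_mul H3_sym -mulmxA Hy c0 scale0r mulmx0.
Qed.

(** By symmetry of K the value of the form K at e_i + e_j and e_i - e_j is
    K_ii - K_jj; [leverage_sum0] computes it. *)
Lemma leverage_diff (R : realType) (P : 'M[R]_3) (X : 'M[R]_(3, 2))
    (q : 'cV[R]_3) (K := leverage X) i j :
  gram_factor P X -> spans_ker P q -> ssum q != 0 ->
  K i i - K j j = - (2%:R / ssum q * (q i 0 - q j 0)).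
Proof.
move=> PX kq s0.
pose f : 'cV[R]_3 := delta_mx i 0 - delta_mx j 0.
(* Subtracting a multiple of q, on which K vanishes, brings the sum to zero. *)
pose p : 'cV[R]_3 := delta_mx i 0 + delta_mx j 0 - (2%:R / ssum q) *: q.
have f0 : ssum f = 0 by rewrite ssumD ssumN !ssum_delta subrr.
have p0 : ssum p = 0 by rewrite !ssumD ssumN ssumZ !ssum_delta; field.
have Kq : q^T *m K = 0.
  have Xq := gram_factor_ker PX (spans_ker_mul0 kq).
  by rewrite /K /leverage !mulmxA -{1}[X]trmxK -trmx_mul Xq trmx0 !mul0mx.
have KT : K^T = K.
  rewrite /K /leverage !trmx_mul trmxK trmx_inv mulmxA; congr (_ *m invmx _ *m _).
  by rewrite /Smx !trmx_mul trmxK H3_sym mulmxA.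
have Kji : K j i = K i j by rewrite -{1}KT mxE.
pose di : 'rV[R]_3 := delta_mx 0 i; pose dj : 'rV[R]_3 := delta_mx 0 j.
have pT : p^T = di + dj - (2%:R / ssum q) *: q^T.
  by rewrite /p [LHS]linearB [X in X - _]linearD [X in _ - X]linearZ /= !trmx_delta.
have pK : p^T *m K = di *m K + dj *m K.
  by rewrite pT mulmxBl -scalemxAl Kq scaler0 subr0 mulmxDl.
have fE (r : 'rV[R]_3) : (r *m f) 0 0 = r 0 i - r 0 j.
  by rewrite mulmxBr -!colE !mxE.
have := leverage_sum0 PX kq s0 f0 p0; rewrite -/K pK => /matrixP/(_ 0 0).
move: Kji; rewrite !fE pT -!rowE; move: (K) => k Kji.
rewrite !mxE !eqxx Kji (eq_sym j i).
move=> E; have -> : k i i - k j j = k i i + k i j - (k i j + k j j) by ring.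
rewrite E; ring.
Qed.

(** The d_i^2 are the diagonal entries of X S X^T, and S = tr(S) I - det(S) S^-1.
    As X X^T = P has unit diagonal, the trace cancels in differences. *)
Lemma dnorm_sqr_diff (R : realType) (P : 'M[R]_3) (X : 'M[R]_(3, 2))
    (q : 'cV[R]_3) i j :
  (forall i, P i i = 1) -> gram_factor P X -> spans_ker P q -> ssum q != 0 ->
  dnorm P i ^+ 2 - dnorm P j ^+ 2
    = 2%:R * \det (Smx X) / ssum q * (q i 0 - q j 0).
Proof.
move=> P1 PX kq s0; have [_ PE] := PX.
have Pq := spans_ker_mul0 kq.
have det0 : \det (Smx X) != 0 by rewrite gt_eqF // pd_det_gt0 //;
  apply: Smx_pd PX Pq s0.
have SE : Smx X = (\tr (Smx X))%:M - \det (Smx X) *: invmx (Smx X).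
  rewrite /invmx unitmxE unitfE det0 scalerA divff // scale1r adj_mx2.
  by rewrite opprB addrC subrK.
have dE k : dnorm P k ^+ 2 =
    \tr (Smx X) - \det (Smx X) * leverage X k k.
  have -> : dnorm P k ^+ 2 = (X *m Smx X *m X^T) k k.
    by rewrite dnorm_sqr /centred_gram /Smx PE trmx_mul trmxK !mulmxA.
  rewrite {1}SE mulmxBr mulmxBl mul_mx_scalar -scalemxAl -PE -scalemxAr -scalemxAl.
  by rewrite -/(leverage X); move: (leverage X) => K; rewrite !mxE P1 mulr1.
have := leverage_diff i j PX kq s0; rewrite !dE; move: (leverage X) => K E.
have -> : forall t d : R, t - d * K i i - (t - d * K j j) = - d * (K i i - K j j).
  by move=> t d; ring.
by rewrite E; ring.
Qed.

(** * The correlation map on rank-two matrices *)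

Theorem proposition5 (R : realType) (P : 'M[R]_3) (q : 'cV[R]_3)
    (HP : corrmx_nd P) (rkP : \rank P = 2%N) (Hq : spans_ker P q) :
  (exists X : 'M[R]_(3, 2), gram_factor P X) /\
  (* 1 *)
  ((ssum q = 0 <-> \rank (corrmap P) = 1%N) /\
   (ssum q = 0 ->
      [/\ corrmap P = Amx 1 (-1) (-1) \/
          corrmap P = Amx (-1) 1 (-1) \/
          corrmap P = Amx (-1) (-1) 1,
          corrmx_nd (corrmap P),
          \rank (corrmap P) = 1%N
        & corrmap (corrmap P) = corrmap P])) /\
  (* 2 *)
  (ssum q != 0 ->
     (forall X : 'M[R]_(3, 2), gram_factor P X -> pdmx (Smx X)) /\
     [/\ corrmx_nd (corrmap P),
         \rank (corrmap P) = 2%N,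
         kappa (corrmap P) = <[Dmx P *m q]>%VS
       & spans_ker (corrmap P) (Dmx P *m q)]) /\
  (* 3 *)
  ((ssum q != 0 ->
      forall X : 'M[R]_(3, 2), gram_factor P X ->
      forall i j : 'I_3,
        dnorm P i ^+ 2 - dnorm P j ^+ 2
        = 2%:R * \det (Smx X) / ssum q * (q i 0 - q j 0)) /\
   (forall X Y : 'M[R]_(3, 2), gram_factor P X -> gram_factor P Y ->
      \det (Smx X) = \det (Smx Y))) /\
  (* 4 *)
  (ssum q != 0 ->
     let q' := if 0 < ssum q then q else - q in
     0 < ssum q' /\
     (forall i j : 'I_3, q' j 0 < q' i 0 <-> dnorm P j < dnorm P i) /\
     spans_ker (corrmap P) (Dmx P *m q') /\
     (forall i j : 'I_3, q' i 0 = q' j 0 ->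
        (Dmx P *m q') i 0 = (Dmx P *m q') j 0)).
Proof.
have [[Pp P1] ncP] := HP; have [PT _] := Pp.
have q0 := Hq.1.
have Pq := spans_ker_mul0 Hq.
have kerC (v : 'cV[R]_3) : spans_ker P v -> ssum v != 0 ->
    spans_ker (corrmap P) (Dmx P *m v) by exact: spans_ker_corrmap.
have CC := corrmx_corrmap ncP; have CT := CC.1.1.
have rk2 : ssum q != 0 -> \rank (corrmap P) = 2%N.
  by move=> s0; apply: rank_spans_ker CT (kerC q Hq s0).
have exX : exists X : 'M[R]_(3, 2), gram_factor P X.
  have [|X PX] := @psd_gram _ _ 2 _ Pp; first by rewrite rkP.
  exists X; split=> //; apply/eqP; rewrite eqn_leq rank_leq_col /=.
  by apply: leq_trans (mxrankM_maxl X X^T); rewrite -PX rkP.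
have part1 : ssum q = 0 ->
    [/\ corrmap P = Amx 1 (-1) (-1) \/ corrmap P = Amx (-1) 1 (-1) \/
          corrmap P = Amx (-1) (-1) 1,
        corrmx_nd (corrmap P), \rank (corrmap P) = 1%N
      & corrmap (corrmap P) = corrmap P].
  move=> /(sum0_sign_mix PT P1 (ncP 0) q0 Pq)[t [e [t1 -> e1 nce eA]]].
  by rewrite corrmap_sign_mix //; have [] := sign_fixed e1 nce.
split=> //; split; [split=> // | split; [|split; [split|]]].
- split=> [/part1[]//|rk1]; apply/eqP; apply: contraTT isT => /rk2.
  by rewrite rk1.
- move=> s0; split; first by move=> X PX; apply: Smx_pd PX Pq s0.
  split; last exact: kerC; last exact/spans_ker_kappa/kerC; last exact: rk2.
  exact: corrmx_nd_rank CC (rk2 s0).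
- by move=> s0 X PX i j; apply: dnorm_sqr_diff.
- by move=> X Y; apply: det_Smx_unique.
move=> s0 q'.
have s'0 : 0 < ssum q'.
  rewrite /q'; case: (ltP 0 (ssum q)) => // s_le0.
  by rewrite ssumN oppr_gt0 lt_neqAle s0.
have Hq' : spans_ker P q' by rewrite /q'; case: ifP => // _; apply: spans_kerN.
have s'n0 : ssum q' != 0 by rewrite gt_eqF.
have d0 i : 0 <= dnorm P i by apply/ltW/dnorm_nonconst_gt0.
have [X PX] := exX.
have dq i j : exists2 c, 0 < c &
    dnorm P i ^+ 2 - dnorm P j ^+ 2 = c * (q' i 0 - q' j 0).
  exists (2%:R * \det (Smx X) / ssum q'); last exact: dnorm_sqr_diff.
  rewrite divr_gt0 // mulr_gt0 // pd_det_gt0 //; apply: Smx_pd PX _ s'n0.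
  exact: spans_ker_mul0.
split=> //; split; [|split; first exact: kerC].
  move=> i j; have [c c0 E] := dq i j.
  suff -> : (q' j 0 < q' i 0) = (dnorm P j < dnorm P i) by [].
  rewrite -[RHS](@ltr_pXn2r _ 2) ?nnegrE // -[LHS]subr_gt0 -[RHS]subr_gt0 E.
  by rewrite pmulr_rgt0.
move=> i j qij; have [c _] := dq i j; rewrite qij subrr mulr0 => /eqP.
rewrite subr_eq0 eqrXn2 // => /eqP dij.
by rewrite /Dmx mul_diag_mx !mxE dij qij.
Qed.
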